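(* Every admissible algebra of nil-index $\le3$ has a grading.
   Context: $\mathbb F$ is a field of characteristic $0$; all algebras are associative $\mathbb F$-algebras. For an algebra $\mathcal N$ put $\mathcal N^1=\mathcal N$ and let $\mathcal N^{k+1}$ be the linear span of $\mathcal N\mathcal N^k$; $\mathcal N$ is nilpotent if $\mathcal N^{k+1}=0$ for some $k\ge0$, and the minimal such $k$ is the nil-index $\nu(\mathcal N)$. An admissible algebra is a commutative nilpotent algebra $\mathcal N$ of finite dimension over $\mathbb F$ whose annihilator $\{x\in\mathcal N:x\mathcal N=0\}$ has dimension $1$. A grading of $\mathcal N$ is a vector space decomposition $\mathcal N=\bigoplus_{k\in\mathbb Z^+}\mathcal N_k$, indexed by the positive integers, with $\mathcal N_j\mathcal N_k\subset\mathcal N_{j+k}$ for all $j,k>0$. *)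

(* Defs.v *)
From HB Require Import structures.
From mathcomp Require Import all_boot all_order all_algebra.

Set Implicit Arguments.
Unset Strict Implicit.
Unset Printing Implicit Defensive.

Import GRing.Theory.

Local Open Scope ring_scope.

(* Nilpotent algebras have no unit, so an F-algebra is given here as a        *)
(* finite-dimensional vector space N with a bilinear product mul;             *)
(* associativity and commutativity are stated as separate hypotheses.         *)
Section NonUnitalAlgebra.

Variables (F : fieldType) (N : vectType F) (mul : {bilinear N -> N -> N}).
Implicit Types (U V W : {vspace N}) (G : nat -> {vspace N}).

(* The linear span of all products of an element of U by an element of V:     *)
(* by bilinearity the products of basis vectors suffice (see alg_prodP).      *)
Definition alg_prod U V : {vspace N} :=
  <<[seq mul u v | u <- vbasis U, v <- vbasis V]>>%VS.

Lemma mem_alg_prod U V u v : u \in U -> v \in V -> mul u v \in alg_prod U V.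
Proof.
move=> /coord_vbasis-> /coord_vbasis->.
rewrite linear_sumr memv_suml // => j _.
rewrite linear_sumlz memv_suml // => i _.
rewrite linearZr_LR linearZl_LR !memvZ //.
by rewrite memv_span //; apply/allpairsP; exists ((vbasis U)`_i, (vbasis V)`_j);
  rewrite !memt_nth.
Qed.

Lemma alg_prodP U V W :
  reflect {in U & V, forall u v, mul u v \in W} (alg_prod U V <= W)%VS.
Proof.
apply: (iffP idP) => [sUVW u v Uu Vv | sUVW].
  by rewrite (subvP sUVW) ?mem_alg_prod.
apply/span_subvP => _ /allpairsP[[u v] /= [Uu Vv ->]].
by rewrite sUVW ?vbasis_mem.
Qed.

(* alg_pow k is N^k for k >= 1; the value at k = 0 is junk (equal to N).      *)
Definition alg_pow (k : nat) : {vspace N} := iter k.-1 (alg_prod fullv) fullv.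

Lemma alg_pow1 : alg_pow 1 = fullv.
Proof. by []. Qed.

Lemma alg_powS k : (0 < k)%N -> alg_pow k.+1 = alg_prod fullv (alg_pow k).
Proof. by case: k. Qed.

Definition nilpotent : Prop := exists k, alg_pow k.+1 == 0%VS.

Definition nil_index (nilN : nilpotent) : nat := ex_minn nilN.

Definition annihilator : {vspace N} := lker (linfun (fun x => linfun (mul x))).

Lemma annihilatorP x : reflect (forall y, mul x y = 0) (x \in annihilator).
Proof.
have lin1 : linear (fun x => linfun (mul x)).
  move=> a u v; apply/lfunP => y; rewrite add_lfunE !lfunE /= linearPl.
  by congr (_ + _); congr (_ *: _); rewrite lfunE.
pose M := GRing.isLinear.Build _ _ _ _ _ lin1.
pose L : {linear N -> 'Hom(N, N)} := HB.pack (fun x => linfun (mul x)) M.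
have LE : linfun (fun x => linfun (mul x)) x = linfun (mul x) by exact: (lfunE L).
rewrite memv_ker LE; apply: (iffP eqP) => [Lx0 y | mx0].
  by have /lfunP/(_ y) := Lx0; rewrite !lfunE.
by apply/lfunP => y; rewrite !lfunE /= mx0.
Qed.

Record admissible : Prop := Admissible {
  admissible_comm : commutative mul;
  admissible_nilpotent : nilpotent;
  admissible_ann : \dim annihilator = 1%N
}.

(* N is the internal direct sum of the G k, k >= 1: the sum of these          *)
(* subspaces is direct and every element of N lies in a finite partial sum.   *)
(* The value G 0 is never used.                                               *)
Record grading G : Prop := Grading {
  grading_direct : forall n, directv (\sum_(k < n | (0 < k)%N) G k)%VS;
  grading_full : forall x : N,
    exists n, x \in (\sum_(k < n | (0 < k)%N) G k)%VS;
  grading_mul : forall j k, (0 < j)%N -> (0 < k)%N ->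
    {in G j & G k, forall x y, mul x y \in G (j + k)%N}
}.

End NonUnitalAlgebra.

(* Main.v *)
(* Let A be the annihilator, spanned by a, and let w be a linear form with    *)
(* w(a) = 1. As N^4 = 0, the form w(xy) has radical A, so that                *)
(* c(x,y) = w(xy) + w(x)w(y) is nondegenerate. The ideal P = {x : xN <= A}    *)
(* contains N^2, and its orthogonal lies in P; using 1/2, an arbitrary        *)
(* complement of P can be corrected to an isotropic one inside ker w. Let e   *)
(* be the projection onto that complement with kernel P and f its             *)
(* c-adjoint: e, f, the projection w(.)a onto A and the remainder             *)
(* g = 1 - e - f - w(.)a are orthogonal idempotents, and their images in      *)
(* degrees 2, 4, 6 and 3 respectively grade N. The point is that a product    *)
(* with a factor in P lies in A, hence vanishes as soon as w does.            *)

Require Import Defs.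
From HB Require Import structures.
From mathcomp Require Import all_boot all_order all_algebra.

Set Implicit Arguments.
Unset Strict Implicit.
Unset Printing Implicit Defensive.

Import GRing.Theory.

Local Open Scope ring_scope.

(** Multiplication table: write N_2, N_3, N_4, N_6 for the images of [e], [g], [f] and the
    projection onto A. Isotropy of N_2 and adjointness of [e] and [f] give N_2 N_2 <= N_4. The
    products N_2 N_4 and N_3 N_3 have a factor in [P], hence lie in A = N_6. All others vanish: A
    kills N, and in the remaining cases the factors are orthogonal with one of them in [P]. The
    adjoint comes from [exists_adjoint]; [grading_of_idempotents] turns the projections into a
    grading. *)

Section LinearAlgebra.

Variables (F : fieldType) (N : vectType F).

Lemma linear_linfunE (aT rT : vectType F) (f : aT -> rT) :
  linear f -> linfun f =1 f.
Proof.
move=> lin_f; pose M := GRing.isLinear.Build _ _ _ _ _ lin_f.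
pose L : {linear aT -> rT} := HB.pack f M.
exact: (lfunE L).
Qed.

(** An injective [C] is onto the dual by a dimension count, so the functional [C x \o p] is
    represented by a vector, taken as [q x]. *)
Lemma exists_adjoint (C : 'Hom(N, 'Hom(N, F^o))) (p : 'End(N)) :
  (forall x, C x = 0 -> x = 0) ->
  exists q : 'End(N), forall x y, C (q x) y = C x (p y).
Proof.
move=> nondegC; have kerC : lker C == 0%VS.
  by apply/lker0P => x y eqC; apply/subr0_eq/nondegC; rewrite linearB /= eqC subrr.
have imC : limg C = fullv.
  apply/eqP; rewrite eqEdim subvf limg_dim_eq ?(eqP kerC) ?capv0 //=.
  by rewrite !dimvf /dim /= muln1.
pose q x := (C^-1)%VF (C x \o p)%VF.
have lin_q : linear q.
  by move=> a u v; rewrite /q linearP /= comp_lfunDl -comp_lfunZl linearP.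
exists (linfun q) => x y; rewrite linear_linfunE // /q.
by rewrite limg_lfunVK ?imC ?memvf // comp_lfunE.
Qed.

Lemma exists_functional (a : N) :
  a != 0 -> exists w : 'Hom(N, F^o), w a = 1.
Proof.
move=> a0; pose X := [tuple a].
have freeX : free X by rewrite seq1_free.
pose f x : F^o := coord X ord0 (projv <[a]> x).
have lin_f : linear f by move=> k u v; rewrite /f !linearP.
exists (linfun f); rewrite linear_linfunE // /f projv_id ?memv_line //.
by have := coord_free ord0 ord0 freeX; rewrite eqxx.
Qed.

Lemma exists_projection_with_kernel (P : {vspace N}) :
  exists2 p : 'End(N), forall x, p (p x) = p x & lker p = P.
Proof.
exists (\1 - projv P)%VF => [x|].
  by rewrite !(add_lfunE, opp_lfunE, id_lfunE) linearB /= projv_proj subrr subr0.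
apply/vspaceP => x; rewrite memv_ker !(add_lfunE, opp_lfunE, id_lfunE) subr_eq0.
by apply/eqP/idP => [->|/projv_id->]; rewrite ?memv_proj.
Qed.

(** Directness holds because [E i] extracts the [i]-th term of a vanishing sum. Images are written
    as fixed spaces, so that membership is an equation. *)
Lemma grading_of_idempotents (mul : {bilinear N -> N -> N}) (E : nat -> 'End(N))
    (m : nat) :
    (forall j k x, E j (E k x) = if j == k then E k x else 0) ->
    (forall x, x = \sum_(k < m | (0 < k)%N) E k x) ->
    (forall j k x y, (0 < j)%N -> (0 < k)%N ->
       E (j + k)%N (mul (E j x) (E k y)) = mul (E j x) (E k y)) ->
  grading mul (fun k => fixedSpace (E k)).
Proof.
move=> orthE sumE mulE; split=> [n|x|j k j0 k0 x y].
- apply/directv_sum_independent => us fix_us sum0 i i0.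
  have := congr1 (E i) sum0; rewrite linear0 linear_sum (bigD1 i) //=.
  rewrite big1 => [|k /andP[k0 ki]].
    by rewrite addr0 (fixedSpaceP (fix_us i i0)).
  rewrite -(fixedSpaceP (fix_us k k0)) orthE ifN //.
  by rewrite eq_sym; apply: contra ki => /eqP/val_inj->.
- exists m; rewrite [x]sumE memv_suml // => k k0.
  by apply: (subvP (sumv_sup k k0 (subvv _))); apply/fixedSpaceP; rewrite orthE eqxx.
- by move=> /fixedSpaceP<- /fixedSpaceP<-; apply/fixedSpaceP/mulE.
Qed.

End LinearAlgebra.

Section NilpotentAlgebra.

Variables (F : fieldType) (N : vectType F) (mul : {bilinear N -> N -> N}).

Lemma alg_pow_eq0_leq j k :
  (j <= k)%N -> alg_pow mul j.+1 = 0%VS -> alg_pow mul k.+1 = 0%VS.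
Proof.
move=> /subnKC<- Nj0; elim: (k - j)%N => [|d IHd]; first by rewrite addn0.
rewrite addnS alg_powS // IHd; apply/eqP; rewrite -subv0; apply/alg_prodP.
by move=> u v _; rewrite !memv0 => /eqP->; rewrite linear0r.
Qed.

Lemma alg_pow_nil_index (nilN : nilpotent mul) k :
  (nil_index nilN <= k)%N -> alg_pow mul k.+1 = 0%VS.
Proof.
by rewrite /nil_index; case: ex_minnP => j /eqP Nj0 _ le_jk; apply: alg_pow_eq0_leq Nj0.
Qed.

Lemma mul4_eq0 x y z t :
  alg_pow mul 4 = 0%VS -> mul x (mul y (mul z t)) = 0.
Proof.
move=> N4; apply/eqP; rewrite -memv0 -N4.
by rewrite !mem_alg_prod ?memvf.
Qed.

(** The condition is linear in [x]: it says that the map sending [y] to multiplication by [mul x y]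
    is zero. *)
Lemma exists_ideal_annihilator :
  exists P : {vspace N}, forall x,
    x \in P <-> forall y z, mul (mul x y) z = 0.
Proof.
have linJ : linear (fun x => linfun (mul x)).
  move=> a u v; apply/lfunP => y; rewrite add_lfunE scale_lfunE !lfunE /=.
  exact: linearPl.
pose J := linfun (fun x => linfun (mul x)).
have JE x y : J x y = mul x y by rewrite [J x]linear_linfunE // lfunE.
have linK : linear (fun x => J \o J x)%VF.
  by move=> a u v; rewrite linearP /= comp_lfunDr -comp_lfunZr.
exists (lker (linfun (fun x => J \o J x)%VF)) => x.
rewrite memv_ker linear_linfunE //; split=> [/eqP Jx y z|Jx].
  by rewrite -(JE x) -(JE _ z) -comp_lfunE Jx !zero_lfunE.
by apply/eqP/lfunP => y; apply/lfunP => z; rewrite comp_lfunE !JE !zero_lfunE Jx.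
Qed.

End NilpotentAlgebra.

Theorem mainTheorem8 (F : fieldType) (charF0 : [pchar F] =i pred0)
    (N : vectType F) (mul : {bilinear N -> N -> N}) (mulA : associative mul)
    (admN : admissible mul)
    (nil_le3 : (nil_index (admissible_nilpotent admN) <= 3)%N) :
  exists G : nat -> {vspace N}, grading mul G.
Proof.
have N4 := alg_pow_nil_index nil_le3.
have mulC := admissible_comm admN; have dimA := admissible_ann admN.
have m4 x y z t : mul x (mul y (mul z t)) = 0 by exact: mul4_eq0.
have [a a0 defA] : exists2 a, a != 0 & annihilator mul = <[a]>%VS.
  exists (vpick (annihilator mul)).
    by rewrite vpick0; apply/eqP => A0; move: dimA; rewrite A0 dimv0.
  apply/esym/eqP; rewrite eqEdim -memvE memv_pick dim_vline dimA vpick0.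
  by case: eqP => // A0; move: dimA; rewrite A0 dimv0.
have annE x : (forall y, mul x y = 0) -> exists k, x = k *: a.
  by move/annihilatorP; rewrite defA => /vlineP.
have ax y : mul a y = 0 by apply/annihilatorP: y; rewrite defA memv_line.
have xa x : mul x a = 0 by rewrite mulC.
have [w wa] := exists_functional a0.
have wZ k : w (k *: a) = k by rewrite linearZ /= wa [LHS]mulr1.
have ann_w0 x : (forall y, mul x y = 0) -> w x = 0 -> x = 0.
  by move=> /annE[k ->]; rewrite wZ => ->; rewrite scale0r.
have [P PP] := exists_ideal_annihilator mul.
have aP : a \in P by apply/PP => y z; rewrite ax linear0l.
have mulP x y : mul x y \in P by apply/PP => z t; rewrite -!mulA m4.
have w0P x y : x \in P -> w (mul x y) = 0 -> mul x y = 0.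
  by move/PP=> Px; apply: ann_w0.
(* Since N^4 = 0, triple products lie in the annihilator, where [w] is injective. *)
have memP_w x : (forall y z, w (mul x (mul y z)) = 0) -> x \in P.
  move=> wx; apply/PP => y z; rewrite -mulA; apply: ann_w0 => // t.
  by rewrite mulC 2!mulA mulC -mulA !m4.
have w_nondeg x : (forall y, w (mul x y) = 0) -> forall y, mul x y = 0.
  by move=> wx; have Px : x \in P by [apply: memP_w]; move=> y; apply: w0P.
(* The second term removes the degeneracy of [w (mul x y)] along [a]: it makes [c a a = 1]. *)
pose c x y : F := w (mul x y) + w x * w y.
have cD x : linear (c x : N -> F^o).
  move=> k u v; rewrite /c linearPr !linearP /= mulrDr /GRing.scale /=.
  by rewrite [X in _ + (X + _)]mulrCA mulrDr addrACA.
have cC x y : c x y = c y x by rewrite /c mulC [_ * w x]mulrC.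
have linC : linear (fun x => linfun (c x : N -> F^o)).
  move=> k u v; apply/lfunP => y; rewrite add_lfunE scale_lfunE !linear_linfunE //.
  by rewrite ![c _ y]cC [LHS]cD.
pose C := linfun (fun x => linfun (c x : N -> F^o)).
have CE x y : C x y = c x y by rewrite [C x]linear_linfunE // linear_linfunE.
have c_nondeg x : (forall y, c x y = 0) -> x = 0.
  move=> cx; have wx0 : w x = 0.
    by have := cx a; rewrite /c xa linear0 add0r wa mulr1.
  apply: ann_w0 => //; apply: w_nondeg => y.
  by have := cx y; rewrite /c wx0 mul0r addr0.
have endoBZ (u : 'End(N)) k x y : u (x - k *: y) = u x - k *: u y.
  by rewrite linearD linearN linearZ.
have lin_wa : linear (fun x => w x *: a).
  by move=> k u v; rewrite linearP /= scalerDl scalerA.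
pose al : 'End(N) := linfun (fun x => w x *: a).
have alE x : al x = w x *: a by rewrite linear_linfunE.
(* Removing the component along [a] puts the image of [p] in the kernel of    *)
(* [w], where [c x y] is just [w (mul x y)].                                  *)
have [p0 p0p kerp0] := exists_projection_with_kernel P.
have p0P x : (p0 x == 0) = (x \in P) by rewrite -kerp0 memv_ker.
pose p : 'End(N) := p0 - (al \o p0)%VF.
have pE x : p x = p0 x - w (p0 x) *: a by rewrite add_lfunE opp_lfunE comp_lfunE alE.
have p0a : p0 a = 0 by apply/eqP; rewrite p0P.
have pP x : x \in P -> p x = 0.
  by rewrite pE -p0P => /eqP->; rewrite linear0 scale0r subr0.
have pp x : p (p x) = p x.
  by rewrite [X in p X]pE endoBZ (pP a) // scaler0 subr0 !pE p0p.
have wp x : w (p x) = 0 by rewrite pE linearB /= wZ subrr.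
have p_id x : x - p x \in P.
  by rewrite -p0P pE !linearB linearZ /= p0a scaler0 p0p oppr0 subr0 subrr.
have memP x : p x = 0 -> x \in P by move=> px; have := p_id x; rewrite px subr0.
have [q cq] : exists q : 'End(N), forall x y, c (q x) y = c x (p y).
  have [|q qP] := @exists_adjoint _ _ C p.
    by move=> x Cx; apply: c_nondeg => y; rewrite -CE Cx zero_lfunE.
  by exists q => x y; rewrite -!CE.
have c0 x : c x 0 = 0 by rewrite /c linear0r !linear0 mulr0 addr0.
have wq x : w (q x) = 0.
  by have := cq x a; rewrite (pP a) // c0 /c xa linear0 add0r wa mulr1.
(* The image of [q] is orthogonal to [P], the kernel of [p]. As [P] contains all products, [memP_w]
   then puts this image inside [P]. *)
have wqP x y : y \in P -> w (mul (q x) y) = 0.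
  by move=> Py; have := cq x y; rewrite pP // c0 /c wq mul0r addr0.
have qP x : q x \in P by apply: memP_w => y z; rewrite wqP.
have pq x : p (q x) = 0 by rewrite pP.
have qa : q a = 0.
  by apply: c_nondeg => y; rewrite cq /c ax linear0 wp mulr0 addr0.
have c_inj x y : (forall z, c x z = c y z) -> x = y.
  move=> cxy; apply/subr0_eq/c_nondeg => z.
  rewrite cC -[x - y]addrC -scaleN1r [LHS]cD ![c z _]cC cxy.
  by rewrite scaleN1r addNr.
have qq x : q (q x) = q x by apply: c_inj => z; rewrite !cq pp.
pose h : F := 2%:R^-1.
have hh : h + h = 1.
  rewrite -mulr2n -mulr_natl mulfV //.
  by rewrite (pcharf0P _).1.
(* [c (p x) (p y) = c (q (p x)) y], so as [p q = 0] subtracting [q p / 2]     *)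
(* from [p] makes its image isotropic for [c].                                *)
pose e : 'End(N) := p - h *: (q \o p)%VF.
pose f : 'End(N) := q - h *: (q \o p)%VF.
have eE x : e x = p x - h *: q (p x).
  by rewrite add_lfunE opp_lfunE scale_lfunE comp_lfunE.
have fE x : f x = q (x - h *: p x).
  by rewrite add_lfunE opp_lfunE scale_lfunE comp_lfunE endoBZ.
have pe x : p (e x) = p x by rewrite eE endoBZ pp pq scaler0 subr0.
have eP x : x \in P -> e x = 0.
  by move=> Px; rewrite eE pP // linear0 scaler0 subr0.
have ee x : e (e x) = e x by rewrite eE pe -eE.
have fP x : f x \in P by rewrite fE.
have ef x : e (f x) = 0 by rewrite eP.
have ff x : f (f x) = f x by rewrite [f x]fE fE pq scaler0 subr0 qq.
(* Once [f] is known to be adjoint to [e], this is the isotropy of the image of [e]. *)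
have fe x : f (e x) = 0.
  rewrite fE pe eE !endoBZ qq.
  by rewrite -addrA -opprD -scalerDl hh scale1r subrr.

have cBZl k x y z : c (x - k *: y) z = c x z - k * c y z.
  by rewrite ![c _ z]cC addrC -scaleNr [LHS]cD [X in X + _]mulNr addrC.
(* By [cqp], [q \o p] is self-adjoint, so the same correction turns the adjoint pair [p], [q] into
   the adjoint pair [e], [f]. *)
have cfe x y : c (f x) y = c x (e y).
  have cqp : c (q (p x)) y = c (q (p y)) x by rewrite !cq cC.
  by rewrite [RHS]cC eE fE endoBZ !cBZl cqp [c (p y) x]cC cq.
have we x : w (e x) = 0 by rewrite eE linearB linearZ /= wp wq scaler0 subrr.
have wf x : w (f x) = 0 by rewrite fE.
have ea : e a = 0 by rewrite eP.
have fa : f a = 0 by rewrite fE pP // scaler0 subr0.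
pose g : 'End(N) := \1%VF - e - f - al.
have gE x : g x = x - e x - f x - w x *: a.
  by rewrite !(add_lfunE, opp_lfunE) id_lfunE alE.
have ale x : al (e x) = 0 by rewrite alE we scale0r.
have alf x : al (f x) = 0 by rewrite alE wf scale0r.
have eal x : e (al x) = 0 by rewrite alE linearZ /= ea scaler0.
have fal x : f (al x) = 0 by rewrite alE linearZ /= fa scaler0.
have alal x : al (al x) = al x by rewrite !alE wZ.
have eg x : e (g x) = 0.
  by rewrite gE !linearB -alE /= ee ef eal !subr0 subrr.
have fg x : f (g x) = 0.
  by rewrite gE !linearB -alE /= fe ff fal !subr0 subrr.
have wg x : w (g x) = 0 by rewrite gE !linearB /= we wf wZ !subr0 subrr.
have alg x : al (g x) = 0 by rewrite alE wg scale0r.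
have ge x : g (e x) = 0 by rewrite gE ee fe we scale0r !subr0 subrr.
have gf x : g (f x) = 0 by rewrite gE ef ff wf scale0r !subr0 subrr.
have gal x : g (al x) = 0 by rewrite gE eal fal !subr0 !alE wZ subrr.
have gg x : g (g x) = g x by rewrite {1}gE eg fg wg scale0r !subr0.
have gP x : g x \in P.
  by apply: memP; rewrite -pe eg linear0.
have alM x y : x \in P -> al (mul x y) = mul x y.
  by move=> /PP Px; have [k ->] := annE _ (Px y); rewrite alE wZ.
have aM x y : mul (al x) y = 0 by rewrite alE linearZl_LR /= ax scaler0.
have Ma x y : mul x (al y) = 0 by rewrite mulC aM.
have fM x y : y \in P -> mul (f x) y = 0.
  by move=> Py; rewrite w0P // fE wqP.
have Mf x y : x \in P -> mul x (f y) = 0 by move=> Px; rewrite mulC fM.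
(* With u the product, c(f u, z) = c(u, e z) = w(u (e z)), and e z may be replaced by z because z -
   e z lies in [P], which kills u. *)
have eMe x y : f (mul (e x) (e y)) = mul (e x) (e y).
  have wee : w (mul (e x) (e y)) = 0.
    by have := cfe (e x) y; rewrite fe cC c0 /c !we mulr0 addr0.
  apply: c_inj => z; rewrite cfe /c wee !mul0r !addr0; congr (w _).
  have /PP Pz : z - e z \in P by rewrite memP // linearB /= pe subrr.
  rewrite -[in RHS](subrK (e z) z) linearDr /= [X in _ = X + _]mulC.
  by rewrite mulA Pz add0r.
have eMg x y : mul (e x) (g y) = 0.
  rewrite mulC w0P //.
  by have := cfe (g y) x; rewrite fg cC c0 /c wg mul0r addr0.
have gMe x y : mul (g x) (e y) = 0 by rewrite mulC eMg.
have eMf x y : al (mul (e x) (f y)) = mul (e x) (f y) by rewrite mulC alM.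
(* The degrees are chosen so that 2 + 2 = 4 and 2 + 4 = 3 + 3 = 6; all other degrees get the zero
   map, whose fixed space is 0. *)
pose E k : 'End(N) :=
  match k with 2 => e | 3 => g | 4 => f | 6 => al | _ => 0 end.
exists (fun k => fixedSpace (E k)); apply: (@grading_of_idempotents _ _ _ E 7).
- move=> [|[|[|[|[|[|[|j]]]]]]] [|[|[|[|[|[|[|k]]]]]]] x /=;
  by rewrite ?zero_lfunE ?linear0 ?if_same.
- move=> x; rewrite big_mkcond !big_ord_recr big_ord0 /= !zero_lfunE !addr0 !add0r gE alE.
  by rewrite [e x + _]addrC [RHS]addrAC [X in _ = X + _]addrAC [RHS]addrAC !subrK.
- move=> [|[|[|[|[|[|[|j]]]]]]] [|[|[|[|[|[|[|k]]]]]]] x y //= _ _;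
  rewrite ?zero_lfunE ?linear0l ?linear0r ?linear0 ?eMf ?alM // ?aM ?Ma ?eMg ?gMe ?fM ?Mf //.
Qed.
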